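(* (1) If $\{T_1,\dots,T_n\}$ is an independent family of random $d\times d$ positive-semidefinite matrices and $W := \sum_{i=1}^n T_i$, then $$\mathbb{E}\|W\| \ge \frac14\Big[\|\mathbb{E}W\|^{1/2} + \big(\mathbb{E}\max_i\|T_i\|\big)^{1/2}\Big]^2.$$ (2) If $\{Y_1,\dots,Y_n\}$ is an independent family of random $d\times d$ Hermitian matrices with $\mathbb{E}Y_i=0$ for each $i$ and $X := \sum_{i=1}^n Y_i$, then $$\big(\mathbb{E}\|X\|^2\big)^{1/2} \ge \frac12\|\mathbb{E}X^2\|^{1/2} + \frac14\big(\mathbb{E}\max_i\|Y_i\|^2\big)^{1/2}.$$ (3) If $\{S_1,\dots,S_n\}$ is an independent family of random $d_1\times d_2$ complex matrices with $\mathbb{E}S_i=0$ for each $i$ and $Z := \sum_{i=1}^n S_i$, then $$\big(\mathbb{E}\|Z\|^2\big)^{1/2} \ge \frac12\max\Big\{\|\mathbb{E}[ZZ^*]\|^{1/2},\ \|\mathbb{E}[Z^*Z]\|^{1/2}\Big\} + \frac14\big(\mathbb{E}\max_i\|S_i\|^2\big)^{1/2}.$$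
   Context: $\|\cdot\|$ is the spectral norm, ${}^*$ the conjugate transpose. Expectations of random matrices are entrywise and assumed to exist where they appear as hypotheses; other quantities may be $+\infty$, with inequalities understood in $[0,\infty]$. *)

(* Defs.v *)
From HB Require Import structures.
From mathcomp Require Import all_boot all_order all_algebra.
From mathcomp Require Import all_classical all_reals all_analysis.
From mathcomp Require Import complex.

Set Implicit Arguments.
Unset Strict Implicit.
Unset Printing Implicit Defensive.

Import Order.TTheory GRing.Theory Num.Theory.
Local Open Scope classical_set_scope.
Local Open Scope ring_scope.

Section linalg.
Context {R : realType}.
Local Notation C := R[i].

Definition cmod (z : C) : R := Num.sqrt (complex.Re z ^+ 2 + complex.Im z ^+ 2).

Definition vnorm n (v : 'cV[C]_n) : R := Num.sqrt (\sum_(i < n) cmod (v i 0) ^+ 2).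

Definition specnorm m n (A : 'M[C]_(m, n)) : R :=
  sup [set vnorm (A *m x) | x in [set x : 'cV[C]_n | vnorm x <= 1]].

Definition adjmx m n (A : 'M[C]_(m, n)) : 'M[C]_(n, m) := (map_mx (@conjc R) A)^T.

Definition is_hermitian n (A : 'M[C]_n) : Prop := adjmx A = A.

Definition is_psd n (A : 'M[C]_n) : Prop :=
  is_hermitian A /\ forall x : 'cV[C]_n, 0 <= (adjmx x *m A *m x) 0 0.

End linalg.

Section randmx.
Context {R : realType} {dsp : measure_display} {T : measurableType dsp}.
Variable P : probability T R.
Local Notation C := R[i].

Definition mx_coord m n (X : T -> 'M[C]_(m, n)) (k : bool * 'I_m * 'I_n) : T -> R :=
  fun t => if k.1.1 then complex.Re (X t k.1.2 k.2) else complex.Im (X t k.1.2 k.2).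

Definition random_mx m n (X : T -> 'M[C]_(m, n)) : Prop :=
  forall k, measurable_fun setT (mx_coord X k).

Definition mx_sigma m n (X : T -> 'M[C]_(m, n)) : set (set T) :=
  <<s \bigcup_k preimage_set_system setT (mx_coord X k) measurable >>.

Definition mx_independent N m n (X : 'I_N -> T -> 'M[C]_(m, n)) : Prop :=
  forall (J : {set 'I_N}) (A : 'I_N -> set T),
    (forall i, i \in J -> mx_sigma (X i) (A i)) ->
    P (\bigcap_(i in [set i | i \in J]) A i) = (\prod_(i in J) P (A i))%E.

Definition mx_integrable m n (X : T -> 'M[C]_(m, n)) : Prop :=
  forall k, P.-integrable setT (EFin \o mx_coord X k).

Definition Emx m n (X : T -> 'M[C]_(m, n)) : 'M[C]_(m, n) :=
  \matrix_(i, j) (Complex (Rintegral P setT (fun t => complex.Re (X t i j)))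
                          (Rintegral P setT (fun t => complex.Im (X t i j)))).

End randmx.

(* Main.v *)
(*
Jensen's inequality gives E|W| >= |EW| and E|Z|^2 >= |E[ZZ^*]|, |E[Z^*Z]|.  In
the positive-semidefinite case 0 <= T_i <= W yields |T_i| <= |W|, hence
E max_i |T_i| <= E|W|, and (1) follows.  The Hermitian case (2) is (3) with
Z^* = Z.

For (3) it remains to show E max_i |S_i|^2 <= 4 E|Z|^2.  For a set J of indices
let U_J be the sum of the S_i with i in J.  Toggling j in J changes U_J by
+-S_j, so averaging over all J gives max_j |S_j|^2 <= 4 avg_J |U_J|^2, and it
suffices that E|U_J|^2 <= E|Z|^2.  This is conditional Jensen, obtained without
conditional expectations: the norm is a supremum of countably many real-linear
functionals phi, and on an event E of the sigma-algebra of (S_i), i in J, on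
which phi(U_J) >= c >= 0, one has |Z|^2 >= c^2 + 2 c phi(Z - U_J), where the
last term integrates to 0 over E by independence and centering.
*)
Require Import Defs.
From HB Require Import structures.
From mathcomp Require Import all_boot all_order all_algebra.
From mathcomp Require Import all_classical all_reals all_analysis.
From mathcomp Require Import measurable_realfun complex ring lra.

Set Implicit Arguments.
Unset Strict Implicit.
Unset Printing Implicit Defensive.

Import Order.TTheory GRing.Theory Num.Theory.
Local Open Scope classical_set_scope.
Local Open Scope ring_scope.

(** * Real inner product, vector norm and spectral norm *)

Section matrix_norms.
Context {R : realType}.
Local Notation C := R[i].

Lemma cReD (a b : C) : complex.Re (a + b) = complex.Re a + complex.Re b.
Proof. by case: a; case: b. Qed.

Lemma cImD (a b : C) : complex.Im (a + b) = complex.Im a + complex.Im b.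
Proof. by case: a; case: b. Qed.

Lemma cReN (a : C) : complex.Re (- a) = - complex.Re a.
Proof. by case: a. Qed.

Lemma cReM (a b : C) : complex.Re (a * b) =
  complex.Re a * complex.Re b - complex.Im a * complex.Im b.
Proof. by case: a; case: b. Qed.

Lemma cImM (a b : C) : complex.Im (a * b) =
  complex.Re a * complex.Im b + complex.Im a * complex.Re b.
Proof. by case: a => a1 a2; case: b => b1 b2 /=. Qed.

Lemma cRe_sum I (r : seq I) (Q : pred I) (F : I -> C) :
  complex.Re (\sum_(i <- r | Q i) F i) = \sum_(i <- r | Q i) complex.Re (F i).
Proof. by apply: (big_morph _ cReD). Qed.

Lemma cIm_sum I (r : seq I) (Q : pred I) (F : I -> C) :
  complex.Im (\sum_(i <- r | Q i) F i) = \sum_(i <- r | Q i) complex.Im (F i).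
Proof. by apply: (big_morph _ cImD). Qed.

Lemma adjmxM m n p (A : 'M[C]_(m, n)) (B : 'M[C]_(n, p)) :
  adjmx (A *m B) = adjmx B *m adjmx A.
Proof. by rewrite /adjmx map_mxM trmx_mul. Qed.

Lemma adjmxK m n (A : 'M[C]_(m, n)) : adjmx (adjmx A) = A.
Proof. by apply/matrixP => i j; rewrite !mxE conjcK. Qed.

Lemma adjmxE m n (A : 'M[C]_(m, n)) i j : adjmx A i j = (A j i)^*%C.
Proof. by rewrite !mxE. Qed.

(** The real part makes [C^n] a real inner product space with the same norm, so that all estimates
    below concern real-valued, real-linear functionals. *)
Definition rdot n (x y : 'cV[C]_n) : R := complex.Re ((adjmx x *m y) 0 0).

Lemma rdotE n (x y : 'cV[C]_n) : rdot x y =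
  \sum_i (complex.Re (x i 0) * complex.Re (y i 0)
          + complex.Im (x i 0) * complex.Im (y i 0)).
Proof.
rewrite /rdot mxE cRe_sum; apply: eq_bigr => i _.
by rewrite adjmxE; case: (x i 0) => a b; case: (y i 0) => c e /=; rewrite mulNr opprK.
Qed.

Lemma rdotC n (x y : 'cV[C]_n) : rdot x y = rdot y x.
Proof.
rewrite !rdotE; apply: eq_bigr => i _.
by rewrite mulrC [complex.Im (x _ _) * _]mulrC.
Qed.

Lemma rdotDr n (x y z : 'cV[C]_n) : rdot x (y + z) = rdot x y + rdot x z.
Proof. by rewrite /rdot mulmxDr mxE cReD. Qed.

Lemma rdotDl n (x y z : 'cV[C]_n) : rdot (x + y) z = rdot x z + rdot y z.
Proof. by rewrite !(rdotC _ z) rdotDr. Qed.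

Lemma rdotNr n (x y : 'cV[C]_n) : rdot x (- y) = - rdot x y.
Proof. by rewrite /rdot mulmxN mxE cReN. Qed.

Lemma rdotZr n (t : R) (x y : 'cV[C]_n) : rdot x (t%:C *: y)%C = t * rdot x y.
Proof. by rewrite /rdot -scalemxAr mxE cReM /= mul0r subr0. Qed.

Lemma rdotZl n (t : R) (x y : 'cV[C]_n) : rdot (t%:C *: x)%C y = t * rdot x y.
Proof. by rewrite !(rdotC _ y) rdotZr. Qed.

Lemma rdot_adj m n (A : 'M[C]_(m, n)) x y :
  rdot (A *m x) y = rdot x (adjmx A *m y).
Proof. by rewrite /rdot adjmxM mulmxA. Qed.

Lemma rdot_ge0 n (x : 'cV[C]_n) : 0 <= rdot x x.
Proof. by rewrite rdotE; apply: sumr_ge0 => i _; rewrite -!expr2 addr_ge0 ?sqr_ge0. Qed.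

Lemma vnormE n (x : 'cV[C]_n) : vnorm x = Num.sqrt (rdot x x).
Proof.
rewrite /vnorm rdotE; congr Num.sqrt; apply: eq_bigr => i _.
by rewrite /cmod sqr_sqrtr ?addr_ge0 ?sqr_ge0// !expr2.
Qed.

Lemma vnorm_ge0 n (x : 'cV[C]_n) : 0 <= vnorm x.
Proof. exact: sqrtr_ge0. Qed.

Lemma sqr_vnorm n (x : 'cV[C]_n) : vnorm x ^+ 2 = rdot x x.
Proof. by rewrite vnormE sqr_sqrtr ?rdot_ge0. Qed.

Lemma discriminant_le (a b c : R) :
  (forall t, 0 <= a + 2 * b * t + c * t ^+ 2) -> b ^+ 2 <= a * c.
Proof.
move=> h; have a0 : 0 <= a by have := h 0; lra.
have c0 : 0 <= c.
  (* For [c < 0], adding the hypotheses at [t] and [- t] cancels the linear term, and this [t] is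
     large enough to make [a + c * t ^+ 2] negative. *)
  rewrite leNgt; apply/negP => c0; set t := a / (- c) + 1.
  have ct : c * t = c - a by rewrite /t; field; lra.
  have t1 : 1 <= t by rewrite lerDr divr_ge0//; lra.
  by have := h t; have := h (- t); nra.
have [c00|cN0] := eqVneq c 0.
  rewrite c00 mulr0; have [->|b0] := eqVneq b 0; first by rewrite expr0n.
  (* At this point the affine function [a + 2 * b * t] takes the value -1. *)
  have := h (- (a + 1) / (2 * b)); rewrite c00.
  have -> : 2 * b * (- (a + 1) / (2 * b)) = - (a + 1) by field.
  by lra.
(* The quadratic is evaluated at its minimiser. *)
have := h (- b / c).
have -> : a + 2 * b * (- b / c) + c * (- b / c) ^+ 2 = (a * c - b ^+ 2) / c.
  by field.
by rewrite pmulr_lge0 ?subr_ge0// invr_gt0 lt_neqAle eq_sym cN0.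
Qed.

(** Cauchy-Schwarz for a possibly degenerate form: the discriminant bound is applied to the form at
    [x + t y], a nonnegative quadratic in the real number [t]. *)
Lemma psd_form_CS n (B : 'M[C]_n) (hB : is_hermitian B)
    (B0 : forall x, 0 <= rdot (B *m x) x) x y :
  rdot (B *m x) y ^+ 2 <= rdot (B *m x) x * rdot (B *m y) y.
Proof.
apply: discriminant_le => t; have := B0 (x + (t%:C)%C *: y).
rewrite mulmxDr -scalemxAr rdotDl !rdotDr !rdotZl !rdotZr.
have -> : rdot (B *m y) x = rdot (B *m x) y by rewrite rdot_adj hB rdotC.
by move=> /le_trans; apply; rewrite le_eqVlt; apply/orP; left; apply/eqP; ring.
Qed.

Lemma rdot_CS n (x y : 'cV[C]_n) : `|rdot x y| <= vnorm x * vnorm y.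
Proof.
rewrite -(@ler_pXn2r _ 2)// ?nnegrE ?mulr_ge0 ?vnorm_ge0//.
rewrite real_normK ?num_real// exprMn !sqr_vnorm.
apply: discriminant_le => t; have := rdot_ge0 (x + (t%:C)%C *: y).
rewrite rdotDl !rdotDr !rdotZl !rdotZr (rdotC y x).
by move=> /le_trans; apply; rewrite le_eqVlt; apply/orP; left; apply/eqP; ring.
Qed.

Lemma rdot_le n (x y : 'cV[C]_n) : rdot x y <= vnorm x * vnorm y.
Proof. by apply: le_trans (rdot_CS x y); rewrite ler_norm. Qed.

Lemma vnormZ n (t : R) (x : 'cV[C]_n) : vnorm (t%:C *: x)%C = `|t| * vnorm x.
Proof.
by rewrite !vnormE rdotZl rdotZr mulrA -expr2 sqrtrM ?sqr_ge0// sqrtr_sqr.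
Qed.

Lemma vnormD n (x y : 'cV[C]_n) : vnorm (x + y) <= vnorm x + vnorm y.
Proof.
rewrite -(@ler_pXn2r _ 2)// ?nnegrE ?addr_ge0 ?vnorm_ge0//.
rewrite sqr_vnorm rdotDl !rdotDr (rdotC y x) -!sqr_vnorm.
by have := rdot_le x y; nra.
Qed.

Lemma vnormN n (x : 'cV[C]_n) : vnorm (- x) = vnorm x.
Proof. by rewrite !vnormE rdotNr rdotC rdotNr opprK. Qed.

Lemma vnorm0 n : vnorm (0 : 'cV[C]_n) = 0.
Proof. by rewrite vnormE /rdot mulmx0 mxE sqrtr0. Qed.

Lemma vnorm_eq0 n (x : 'cV[C]_n) : vnorm x = 0 -> x = 0.
Proof.
move=> /(congr1 (fun z => z ^+ 2)); rewrite sqr_vnorm expr0n/= rdotE.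
move=> /psumr_eq0P h; apply/matrixP => i j; rewrite (ord1 j) !mxE.
have := h _ i isT; rewrite -!expr2 => /(_ _)/wrap[].
  by move=> k _; rewrite -!expr2 addr_ge0 ?sqr_ge0.
move=> /eqP; rewrite paddr_eq0 ?sqr_ge0// !sqrf_eq0 => /andP[/eqP a /eqP b].
by case: (x i 0) a b => ? ? /= -> ->.
Qed.

Lemma rdot_delta n (x : 'cV[C]_n) i c :
  rdot x (c *: delta_mx i 0) =
  complex.Re (x i 0) * complex.Re c + complex.Im (x i 0) * complex.Im c.
Proof.
rewrite rdotE (bigD1 i)//= big1 ?addr0 ?mxE ?eqxx ?mulr1// => j ji.
by rewrite !mxE (negbTE ji) mulr0 /= !mulr0 addr0.
Qed.

Lemma vnorm_delta n (i : 'I_n) : vnorm (delta_mx i 0 : 'cV[C]_n) = 1.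
Proof.
by rewrite vnormE -[in X in rdot _ X](scale1r (delta_mx i 0)) rdot_delta
  !mxE !eqxx /= mulr1 mulr0 addr0 sqrtr1.
Qed.

(** A crude constant suffices: the bound serves only for boundedness of matrices and density of
    rational vectors. *)
Lemma vnorm_le_sum n (x : 'cV[C]_n) (F : 'I_n -> R) :
  (forall i, `|complex.Re (x i 0)| <= F i) ->
  (forall i, `|complex.Im (x i 0)| <= F i) -> vnorm x <= 2 * \sum_i F i.
Proof.
move=> hr hi; have F0 i : 0 <= F i by apply: le_trans (hr i).
have S0 : 0 <= \sum_i F i by apply: sumr_ge0.
rewrite -(@ler_pXn2r _ 2)// ?nnegrE ?mulr_ge0 ?vnorm_ge0//.
rewrite sqr_vnorm rdotE.
apply: (@le_trans _ _ (\sum_i (2 * \sum_j F j) * F i)).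
  apply: ler_sum => i _; rewrite -!expr2.
  have h : F i <= \sum_j F j by rewrite (bigD1 i)//= lerDl sumr_ge0.
  have := hr i; have := hi i; rewrite !ler_norml => /andP[? ?] /andP[? ?].
  by have := F0 i; nra.
by rewrite -mulr_sumr expr2; nra.
Qed.

(** This makes the supremum defining [specnorm] a genuine one. The real and imaginary parts of a
    coordinate of [A *m x] are inner products of [x] with fixed vectors, obtained by applying
    [adjmx A] to a basis vector or to ['i] times it. *)
Lemma mulmx_bounded m n (A : 'M[C]_(m, n)) :
  exists2 K, 0 <= K & forall x, vnorm (A *m x) <= K * vnorm x.
Proof.
pose r i (c : C) := vnorm (adjmx A *m (c *: delta_mx i 0)).
exists (2 * \sum_i (r i 1 + r i 'i%C)).
  by rewrite mulr_ge0// sumr_ge0// => i _; rewrite addr_ge0 ?vnorm_ge0.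
move=> x; rewrite -mulrA mulr_suml; apply: vnorm_le_sum => i.
  have -> : complex.Re ((A *m x) i 0) = rdot (A *m x) (1 *: delta_mx i 0).
    by rewrite rdot_delta /= mulr1 mulr0 addr0.
  rewrite rdot_adj; apply: le_trans (rdot_CS _ _) _.
  by rewrite mulrC ler_wpM2r ?vnorm_ge0// lerDl vnorm_ge0.
have -> : complex.Im ((A *m x) i 0) = rdot (A *m x) ('i%C *: delta_mx i 0).
  by rewrite rdot_delta /= mulr1 mulr0 add0r.
rewrite rdot_adj; apply: le_trans (rdot_CS _ _) _.
by rewrite mulrC ler_wpM2r ?vnorm_ge0// lerDr vnorm_ge0.
Qed.

Lemma specnorm_has_sup m n (A : 'M[C]_(m, n)) :
  has_sup [set vnorm (A *m x) | x in [set x : 'cV[C]_n | vnorm x <= 1]].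
Proof.
split; first by exists (vnorm (A *m 0)), 0 => //=; rewrite vnorm0 ler01.
have [K K0 h] := mulmx_bounded A.
exists K => _ [x /= x1 <-]; apply: le_trans (h x) _.
by rewrite -[leRHS]mulr1 ler_wpM2l.
Qed.

Lemma specnorm_ge0 m n (A : 'M[C]_(m, n)) : 0 <= specnorm A.
Proof.
have := vnorm_ge0 (A *m 0); move/le_trans; apply; apply: sup_upper_bound.
  exact: specnorm_has_sup.
by exists 0 => //=; rewrite vnorm0 ler01.
Qed.

Lemma vnorm_mulmx m n (A : 'M[C]_(m, n)) x :
  vnorm (A *m x) <= specnorm A * vnorm x.
Proof.
have [x0|x0] := eqVneq (vnorm x) 0.
  by rewrite (vnorm_eq0 x0) mulmx0 !vnorm0 mulr0.
have xp : 0 < vnorm x by rewrite lt_neqAle eq_sym x0 vnorm_ge0.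
rewrite -ler_pdivrMr//.
have -> : vnorm (A *m x) / vnorm x = vnorm (A *m (((vnorm x)^-1)%:C%C *: x)).
  by rewrite -scalemxAr vnormZ ger0_norm ?invr_ge0 ?vnorm_ge0// mulrC.
apply: sup_upper_bound; first exact: specnorm_has_sup.
exists (((vnorm x)^-1)%:C%C *: x) => //=.
by rewrite vnormZ ger0_norm ?invr_ge0 ?vnorm_ge0// mulVf.
Qed.

(** Taking [y = A *m x] and cancelling one factor [vnorm (A *m x)] bounds the norm. Through this
    criterion the norm inequalities below reduce to statements about [rdot]. *)
Lemma specnorm_le m n (A : 'M[C]_(m, n)) (a : R) : 0 <= a ->
  (forall x y, rdot (A *m x) y <= a * vnorm x * vnorm y) -> specnorm A <= a.
Proof.
move=> a0 h; apply: ge_sup; first by have [] := specnorm_has_sup A.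
move=> _ [x /= x1 <-].
have := h x (A *m x); rewrite -sqr_vnorm expr2.
have [->//|Ax] := eqVneq (vnorm (A *m x)) 0.
rewrite ler_pM2r; last by rewrite lt_neqAle eq_sym Ax vnorm_ge0.
by move=> /le_trans; apply; rewrite -[leRHS]mulr1 ler_wpM2l.
Qed.

Lemma rdot_mulmx_le m n (A : 'M[C]_(m, n)) x y :
  rdot (A *m x) y <= specnorm A * vnorm x * vnorm y.
Proof.
apply: le_trans (rdot_le _ _) _.
by rewrite ler_wpM2r ?vnorm_ge0// vnorm_mulmx.
Qed.

Lemma specnormD m n (A B : 'M[C]_(m, n)) :
  specnorm (A + B) <= specnorm A + specnorm B.
Proof.
apply: specnorm_le => [|x y]; first by rewrite addr_ge0 ?specnorm_ge0.
by rewrite mulmxDl rdotDl !mulrDl lerD ?rdot_mulmx_le.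
Qed.

Lemma specnormN m n (A : 'M[C]_(m, n)) : specnorm (- A) = specnorm A.
Proof.
suff h (B : 'M[C]_(m, n)) : specnorm (- B) <= specnorm B.
  by apply/le_anti; rewrite h -[X in specnorm X <= _]opprK h.
apply: specnorm_le => [|x y]; first exact: specnorm_ge0.
by rewrite mulNmx -mulmxN (le_trans (rdot_mulmx_le _ _ _))// vnormN.
Qed.

Lemma specnorm_adj m n (A : 'M[C]_(m, n)) : specnorm (adjmx A) = specnorm A.
Proof.
suff h p q (B : 'M[C]_(p, q)) : specnorm (adjmx B) <= specnorm B.
  by apply/le_anti; rewrite h -[X in specnorm X <= _](adjmxK A) h.
apply: specnorm_le => [|x y]; first exact: specnorm_ge0.
by rewrite rdot_adj adjmxK rdotC mulrAC rdot_mulmx_le.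
Qed.

Lemma specnormM m n p (A : 'M[C]_(m, n)) (B : 'M[C]_(n, p)) :
  specnorm (A *m B) <= specnorm A * specnorm B.
Proof.
apply: specnorm_le => [|x y]; first by rewrite mulr_ge0 ?specnorm_ge0.
rewrite -mulmxA (le_trans (rdot_mulmx_le _ _ _))//.
by rewrite ler_wpM2r ?vnorm_ge0// -mulrA ler_wpM2l ?specnorm_ge0// vnorm_mulmx.
Qed.

(** The quadratic form of [A] is at most that of [A + B], hence at most [s] times the squared vector
    norm. Cauchy-Schwarz for the form of [A] carries this bound from the diagonal to all pairs [x],
    [y]. *)
Lemma specnorm_psd_le n (A B : 'M[C]_n) :
  is_psd A -> is_psd B -> specnorm A <= specnorm (A + B).
Proof.
have psd0 (D : 'M[C]_n) x : is_psd D -> 0 <= rdot (D *m x) x.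
  move=> [hD D0]; have := D0 x; rewrite lecE => /andP[_ /=].
  by rewrite rdotC /rdot mulmxA.
move=> hA hB; apply: specnorm_le => [|x y]; first exact: specnorm_ge0.
set s := specnorm (A + B); have s0 : 0 <= s by apply: specnorm_ge0.
have le x' : rdot (A *m x') x' <= s * vnorm x' * vnorm x'.
  apply: le_trans (rdot_mulmx_le _ _ _).
  by rewrite mulmxDl rdotDl lerDl psd0.
apply: le_trans (ler_norm _) _.
rewrite -(@ler_pXn2r _ 2)// ?nnegrE ?mulr_ge0 ?vnorm_ge0//.
rewrite real_normK ?num_real//.
apply: le_trans (psd_form_CS hA.1 _ x y) _; first by move=> z; apply: psd0.
have := ler_pM (psd0 _ x hA) (psd0 _ y hA) (le x) (le y).
by move=> /le_trans; apply; rewrite le_eqVlt; apply/orP; left; apply/eqP; ring.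
Qed.

Lemma Re_le_specnorm m n (A : 'M[C]_(m, n)) i j :
  `|complex.Re (A i j)| <= specnorm A.
Proof.
have -> : complex.Re (A i j) = rdot (A *m delta_mx j 0) (1 *: delta_mx i 0).
  by rewrite rdot_delta /= mulr1 mulr0 addr0 -colE mxE.
apply: le_trans (rdot_CS _ _) _; rewrite scale1r vnorm_delta mulr1.
by apply: le_trans (vnorm_mulmx _ _) _; rewrite vnorm_delta mulr1.
Qed.

Lemma Im_le_specnorm m n (A : 'M[C]_(m, n)) i j :
  `|complex.Im (A i j)| <= specnorm A.
Proof.
have -> : complex.Im (A i j) = rdot (A *m delta_mx j 0) ('i%C *: delta_mx i 0).
  by rewrite rdot_delta /= mulr1 mulr0 add0r -colE mxE.
apply: le_trans (rdot_CS _ _) _.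
have -> : vnorm ('i%C *: delta_mx i 0 : 'cV[C]_m) = 1.
  rewrite vnormE rdot_delta !mxE !eqxx mulr1 /=.
  by rewrite mulr0 mulr1 add0r sqrtr1.
rewrite mulr1.
by apply: le_trans (vnorm_mulmx _ _) _; rewrite vnorm_delta mulr1.
Qed.

End matrix_norms.

(** * A countable norming family of real-linear functionals *)

Section norming_family.
Context {R : realType}.
Local Notation C := R[i].

(** This is the real part of the trace of [B^T A], the general real-linear functional of [A]. *)
Definition lform m n (B A : 'M[C]_(m, n)) : R :=
  \sum_i \sum_j (complex.Re (B i j) * complex.Re (A i j)
                 - complex.Im (B i j) * complex.Im (A i j)).

Lemma lformD m n (B A A' : 'M[C]_(m, n)) :
  lform B (A + A') = lform B A + lform B A'.
Proof.
rewrite /lform -big_split; apply: eq_bigr => i _; rewrite -big_split.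
by apply: eq_bigr => j _; rewrite mxE cReD cImD /=; ring.
Qed.

(** The matrix that represents the functional [A -> c * rdot (A *m x) y]. *)
Definition outer m n (c : R) (x : 'cV[C]_n) (y : 'cV[C]_m) : 'M[C]_(m, n) :=
  \matrix_(i, j) (c%:C * (x j 0 * (y i 0)^*))%C.

Lemma lform_outer m n c x y (A : 'M[C]_(m, n)) :
  lform (outer c x y) A = c * rdot (A *m x) y.
Proof.
rewrite rdotC /rdot mxE cRe_sum mulr_sumr; apply: eq_bigr => i _.
rewrite adjmxE [(A *m x) i 0]mxE mulr_sumr cRe_sum mulr_sumr; apply: eq_bigr => j _.
rewrite mxE -cReM.
transitivity (complex.Re (c%:C * ((y i 0)^* * (A i j * x j 0)))%C).
  congr complex.Re; ring.
by rewrite cReM /= mul0r subr0.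
Qed.

Definition ratvec n (q : 'cV[rat * rat]_n) : 'cV[C]_n :=
  \col_i (Complex (ratr (q i 0).1) (ratr (q i 0).2)).

Lemma ratvec_dense n (x : 'cV[C]_n) (e : R) : 0 < e ->
  exists q, vnorm (x - ratvec q) <= e.
Proof.
(* The 2 is the constant of [vnorm_le_sum]; [n.+1] rather than [n] keeps the denominator nonzero in
   dimension 0. *)
move=> e0; pose d := e / (2 * n.+1%:R).
have d0 : 0 < d by rewrite divr_gt0 ?mulr_gt0.
have near (a : R) : exists q : rat, `|a - ratr q| <= d.
  have [|q] := @rat_in_itvoo R (a - d) (a + d); first by lra.
  by rewrite in_itv/= => /andP[? ?]; exists q; rewrite ler_norml; lra.
have /fin_all_exists[f hf] i : exists q : rat * rat,
    `|complex.Re (x i 0) - ratr q.1| <= d /\ `|complex.Im (x i 0) - ratr q.2| <= d.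
  by have [q1 ?] := near (complex.Re (x i 0));
     have [q2 ?] := near (complex.Im (x i 0)); exists (q1, q2).
exists (\col_i f i).
apply: (@le_trans _ _ (2 * \sum_(i < n) d)).
  by apply: vnorm_le_sum => i; rewrite !mxE; case: (x i 0) (hf i) => ? ? [].
rewrite sumr_const card_ord -(mulr_natr d n).
have -> : e = 2 * (d * n.+1%:R).
  have : n.+1%:R != 0 :> R by rewrite pnatr_eq0.
  by rewrite /d; move: (n.+1%:R : R) => N N0; field.
by rewrite ler_pM2l// ler_pM2l// ler_nat.
Qed.

(* Only countably many functionals are used, so that suprema over them are
   measurable and a maximiser can be selected measurably. *)
Lemma specnorm_norming m n : exists B : nat -> 'M[C]_(m, n), forall A,
  (forall k, lform (B k) A <= specnorm A) /\
  (forall a, (forall k, lform (B k) A <= a) -> specnorm A <= a).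
Proof.
(* Functionals are normalised by the two vector norms. Since the inverse of 0 is 0, a pair with a
   zero vector gives the zero functional, as does an index that codes no pair. *)
pose F (p : 'cV[rat * rat]_n * 'cV[rat * rat]_m) :=
  outer (vnorm (ratvec p.1) * vnorm (ratvec p.2))^-1 (ratvec p.1) (ratvec p.2).
pose B k := if unpickle k is Some p then F p else 0.
have lF p A : lform (F p) A = (vnorm (ratvec p.1) * vnorm (ratvec p.2))^-1 *
    rdot (A *m ratvec p.1) (ratvec p.2) by exact: lform_outer.
exists B => A; split=> [k|a ha].
  rewrite /B; case: unpickle => [p|]; last first.
    rewrite /lform big1 ?specnorm_ge0// => i _; rewrite big1// => j _.
    by rewrite !mxE !mul0r subrr.
  rewrite lF; set N := vnorm _ * vnorm _.
  have [->|N0] := eqVneq N 0; first by rewrite invr0 mul0r specnorm_ge0.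
  have Np : 0 < N by rewrite lt_neqAle eq_sym N0 mulr_ge0 ?vnorm_ge0.
  by rewrite mulrC ler_pdivrMr// mulrA rdot_mulmx_le.
have {}ha p : lform (F p) A <= a by have := ha (pickle p); rewrite /B pickleK.
have hq q r : rdot (A *m ratvec q) (ratvec r)
    <= a * (vnorm (ratvec q) * vnorm (ratvec r)).
  have := ha (q, r); rewrite lF/=; set N := vnorm _ * vnorm _.
  have [N0 _|N0] := eqVneq N 0.
    rewrite N0 mulr0; apply: le_trans (rdot_mulmx_le _ _ _) _.
    by rewrite -mulrA -/N N0 mulr0.
  have Np : 0 < N by rewrite lt_neqAle eq_sym N0 mulr_ge0 ?vnorm_ge0.
  by rewrite mulrC ler_pdivrMr.
(* The pair of zero vectors gives the zero functional, which [a] bounds. *)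
have a0 : 0 <= a.
  have [q hq0] := @ratvec_dense n 0 1 ltr01.
  have := ha (0, 0); rewrite lF /= (_ : ratvec 0 = 0 :> 'cV[C]_m).
    by rewrite vnorm0 mulr0 invr0 mul0r.
  by apply/matrixP => i j; rewrite !mxE/= !raddf0.
apply: specnorm_le => // x y; rewrite -mulrA.
set K := specnorm A; set X := vnorm x; set Y := vnorm y.
have K0 : 0 <= K by exact: specnorm_ge0.
have X0 : 0 <= X by exact: vnorm_ge0.
have Y0 : 0 <= Y by exact: vnorm_ge0.
(* For [d <= 1], replacing [x] and [y] by rational vectors within [d] costs at most [d * M]; the
   three summands match [h1], [h4] and [h5], and the final 1 makes [M] positive. *)
pose M := K * X + K * (Y + 1) + a * (X + Y + 1) + 1.
have M0 : 0 < M by rewrite /M; nra.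
apply/ler_addgt0Pr => e e0; pose d := Num.min 1 (e / M).
have d0 : 0 < d by rewrite lt_min ltr01 divr_gt0.
have d1 : d <= 1 by rewrite ge_min lexx.
have dM : d * M <= e by rewrite -ler_pdivlMr// ge_min lexx orbT.
have [q hx] := ratvec_dense x d0; have [r hy] := ratvec_dense y d0.
set u := x - ratvec q in hx; set v := y - ratvec r in hy.
have xE : ratvec q = x - u by rewrite /u opprB addrC subrK.
have yE : ratvec r = y - v by rewrite /v opprB addrC subrK.
have qX : vnorm (ratvec q) <= X + d.
  by rewrite xE (le_trans (vnormD _ _))// vnormN lerD2l.
have rY : vnorm (ratvec r) <= Y + d.
  by rewrite yE (le_trans (vnormD _ _))// vnormN lerD2l.
have -> : rdot (A *m x) y = rdot (A *m x) v + rdot (A *m u) (ratvec r)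
    + rdot (A *m ratvec q) (ratvec r).
  by rewrite -addrA -rdotDl -mulmxDr /u subrK -rdotDr /v subrK.
have h1 : rdot (A *m x) v <= K * X * d.
  by rewrite (le_trans (rdot_mulmx_le _ _ _))// ler_wpM2l// mulr_ge0.
have h2 : rdot (A *m u) (ratvec r) <= K * d * (Y + d).
  rewrite (le_trans (rdot_mulmx_le _ _ _))// ler_pM ?mulr_ge0 ?vnorm_ge0//.
  by rewrite ler_wpM2l.
have h3 : rdot (A *m ratvec q) (ratvec r) <= a * ((X + d) * (Y + d)).
  by rewrite (le_trans (hq _ _))// ler_wpM2l// ler_pM ?vnorm_ge0.
apply: le_trans (lerD (lerD h1 h2) h3) _.
have h4 : K * d * (Y + d) <= K * d * (Y + 1).
  by rewrite ler_wpM2l ?lerD2l// mulr_ge0// ltW.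
have h5 : a * ((X + d) * (Y + d)) <= a * (X * Y + d * (X + Y + 1)).
  by rewrite ler_wpM2l//; nra.
apply: (@le_trans _ _ (a * (X * Y) + d * M)); last by rewrite lerD2l.
by rewrite /M; lra.
Qed.

End norming_family.

(** * Integrability together with the value of the integral *)

Section has_integral.
Context {R : realType} {dsp : measure_display} {T : measurableType dsp}.
Variables (mu : {measure set T -> \bar R}) (D : set T) (mD : measurable D).

(** Bundling the two facts lets finite linear combinations transport both at once. *)
Definition has_integral (f : T -> R) (v : R) :=
  mu.-integrable D (EFin \o f) /\ (\int[mu]_(x in D) (f x)%:E = v%:E)%E.

Lemma has_integral0 : has_integral (cst 0) 0.
Proof. by split; [exact: integrable0 | rewrite integral0]. Qed.

Lemma has_integralD f g u v : has_integral f u -> has_integral g v ->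
  has_integral (f \+ g) (u + v).
Proof.
move=> [fi fu] [gi gv]; split; first exact: (integrableD mD fi gi).
under eq_integral do rewrite /= EFinD.
by rewrite (integralD mD fi gi) fu gv.
Qed.

Lemma has_integralZ f v c : has_integral f v ->
  has_integral (fun x => c * f x) (c * v).
Proof.
move=> [fi fv]; split; first exact: (integrableZl mD _ fi).
under eq_integral do rewrite EFinM.
by rewrite (integralZl mD fi) fv.
Qed.

Lemma has_integral_sum I (r : seq I) (Q : pred I) (F : I -> T -> R) V :
  (forall i, Q i -> has_integral (F i) (V i)) ->
  has_integral (fun x => \sum_(i <- r | Q i) F i x) (\sum_(i <- r | Q i) V i).
Proof.
move=> h; rewrite -(fct_sumE r Q F).
elim/big_rec2 : _ => [|i v f Qi]; first exact: has_integral0.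
by apply: has_integralD; exact: h.
Qed.

End has_integral.

(** * Measurability of random matrices and of their norms *)

Section random_matrices.
Context {R : realType} {dsp : measure_display} {T : measurableType dsp}.
Local Notation C := R[i].

Lemma random_mxP m n (X : T -> 'M[C]_(m, n)) :
  (forall i j, measurable_fun setT (fun t => complex.Re (X t i j))) ->
  (forall i j, measurable_fun setT (fun t => complex.Im (X t i j))) ->
  random_mx X.
Proof. by move=> hr hi [[[] i] j]; [exact: hr | exact: hi]. Qed.

Lemma random_mx_Re m n (X : T -> 'M[C]_(m, n)) i j : random_mx X ->
  measurable_fun setT (fun t => complex.Re (X t i j)).
Proof. by move=> /(_ (true, i, j)). Qed.

Lemma random_mx_Im m n (X : T -> 'M[C]_(m, n)) i j : random_mx X ->
  measurable_fun setT (fun t => complex.Im (X t i j)).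
Proof. by move=> /(_ (false, i, j)). Qed.

Lemma random_mx_sum N m n (Q : pred 'I_N) (X : 'I_N -> T -> 'M[C]_(m, n)) :
  (forall i, Q i -> random_mx (X i)) ->
  random_mx (fun t => \sum_(i < N | Q i) X i t).
Proof.
move=> hX; apply: random_mxP => i j.
- rewrite [X in measurable_fun _ X](_ : _ = (fun t =>
      \sum_(k < N) if Q k then complex.Re (X k t i j) else 0)); last first.
    by apply/funext => t; rewrite summxE cRe_sum big_mkcond.
  apply: measurable_sum => k; case: (boolP (Q k)) => Qk; last exact: measurable_cst.
  by apply: random_mx_Re; exact: hX.
- rewrite [X in measurable_fun _ X](_ : _ = (fun t =>
      \sum_(k < N) if Q k then complex.Im (X k t i j) else 0)); last first.
    by apply/funext => t; rewrite summxE cIm_sum big_mkcond.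
  apply: measurable_sum => k; case: (boolP (Q k)) => Qk; last exact: measurable_cst.
  by apply: random_mx_Im; exact: hX.
Qed.

Lemma random_mx_adj m n (X : T -> 'M[C]_(m, n)) :
  random_mx X -> random_mx (fun t => adjmx (X t)).
Proof.
move=> hX; apply: random_mxP => i j.
- rewrite [X in measurable_fun _ X](_ : _ = (fun t => complex.Re (X t j i))).
    exact: random_mx_Re.
  by apply/funext => t; rewrite adjmxE; case: (X t j i).
- rewrite [X in measurable_fun _ X](_ : _ = (fun t => - complex.Im (X t j i))).
    by apply: measurableT_comp => //; exact: random_mx_Im.
  by apply/funext => t; rewrite adjmxE; case: (X t j i).
Qed.

Lemma random_mxM m n p (X : T -> 'M[C]_(m, n)) (Y : T -> 'M[C]_(n, p)) :
  random_mx X -> random_mx Y -> random_mx (fun t => X t *m Y t).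
Proof.
move=> hX hY; apply: random_mxP => i j.
- rewrite [X in measurable_fun _ X](_ : _ = (fun t => \sum_k
    (complex.Re (X t i k) * complex.Re (Y t k j)
     - complex.Im (X t i k) * complex.Im (Y t k j)))); last first.
    by apply/funext => t; rewrite mxE cRe_sum; apply: eq_bigr => k _; rewrite cReM.
  apply: measurable_sum => k; apply: measurable_funB; apply: measurable_funM;
    (exact: random_mx_Re || exact: random_mx_Im).
- rewrite [X in measurable_fun _ X](_ : _ = (fun t => \sum_k
    (complex.Re (X t i k) * complex.Im (Y t k j)
     + complex.Im (X t i k) * complex.Re (Y t k j)))); last first.
    by apply/funext => t; rewrite mxE cIm_sum; apply: eq_bigr => k _; rewrite cImM.
  apply: measurable_sum => k; apply: measurable_funD; apply: measurable_funM;
    (exact: random_mx_Re || exact: random_mx_Im).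
Qed.

Lemma measurable_lform m n (B : 'M[C]_(m, n)) (X : T -> 'M[C]_(m, n)) : random_mx X ->
  measurable_fun setT (fun t => lform B (X t)).
Proof.
move=> hX; apply: measurable_sum => i; apply: measurable_sum => j.
apply: measurable_funB; apply: measurable_funM => //;
  (exact: random_mx_Re || exact: random_mx_Im).
Qed.

(** The norm is the supremum of countably many measurable functions [lform (B k) (X t)], written as
    [esups] from index 0. *)
Lemma measurable_specnorm m n (X : T -> 'M[C]_(m, n)) : random_mx X ->
  measurable_fun setT (fun t => specnorm (X t)).
Proof.
move=> hX; have [B hB] := @specnorm_norming R m n.
apply/measurable_EFinP.
pose u t k := (lform (B k) (X t))%:E.
rewrite [X in measurable_fun _ X](_ : _ = (fun t => esups (u t) 0)).
  apply: measurable_fun_esups => k; apply/measurable_EFinP.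
  exact: measurable_lform.
apply/funext => t /=; apply/esym/le_anti/andP; split.
  apply: ge_ereal_sup => _ [k _ <-]; rewrite lee_fin.
  by have [+ _] := hB (X t); exact.
have ub k : (u t k <= esups (u t) 0%N)%E by apply: ereal_sup_ubound; exists k.
case: (esups (u t) 0) ub => [r| |] ub; [|exact: leey|].
  by rewrite lee_fin; have [_] := hB (X t); apply=> k; rewrite -lee_fin; exact: ub.
by have := ub 0%N; rewrite leNgt ltNyr.
Qed.

End random_matrices.

(** * Expectations of random matrices and Jensen's inequality *)

Section expectation.
Context {R : realType} {dsp : measure_display} {T : measurableType dsp}.
Variable P : probability T R.
Local Notation C := R[i].

Lemma specnorm_integrable m n (X : T -> 'M[C]_(m, n)) : random_mx X ->
  (\int[P]_t (specnorm (X t))%:E < +oo)%E ->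
  P.-integrable setT (fun t => (specnorm (X t))%:E).
Proof.
move=> hX hoo; apply/integrableP; split.
  by apply/measurable_EFinP; exact: measurable_specnorm.
by under eq_integral do rewrite gee0_abs ?lee_fin ?specnorm_ge0//.
Qed.

Lemma mx_integrable_of_specnorm m n (X : T -> 'M[C]_(m, n)) : random_mx X ->
  (\int[P]_t (specnorm (X t))%:E < +oo)%E -> mx_integrable P X.
Proof.
move=> hX hoo k; apply: (le_integrable measurableT _ _ (specnorm_integrable hX hoo)).
  by apply/measurable_EFinP; exact: hX.
move=> t _ /=; rewrite lee_fin (ger0_norm (specnorm_ge0 _)).
by rewrite /mx_coord; case: ifP; rewrite ?Re_le_specnorm ?Im_le_specnorm.
Qed.

Lemma has_integral_lform (D : set T) (mD : measurable D) m n
    (B M : 'M[C]_(m, n)) (X : T -> 'M[C]_(m, n)) :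
  (forall i j, has_integral P D (fun t => complex.Re (X t i j)) (complex.Re (M i j))) ->
  (forall i j, has_integral P D (fun t => complex.Im (X t i j)) (complex.Im (M i j))) ->
  has_integral P D (fun t => lform B (X t)) (lform B M).
Proof.
move=> hr hi; apply: has_integral_sum => // i _; apply: has_integral_sum => // j _.
apply: has_integralD => //; first exact: has_integralZ.
rewrite -mulNr (_ : (fun t => _) = (fun t => - complex.Im (B i j) * complex.Im (X t i j))).
  exact: has_integralZ.
by apply/funext => t; rewrite mulNr.
Qed.

Lemma has_integral_Emx m n (B : 'M[C]_(m, n)) (X : T -> 'M[C]_(m, n)) :
  mx_integrable P X -> has_integral P setT (fun t => lform B (X t)) (lform B (Emx P X)).
Proof.
move=> hX; apply: has_integral_lform => // i j; rewrite mxE/=; split.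
- exact: hX (true, i, j).
- by rewrite fineK//; apply: integrable_fin_num (hX (true, i, j)).
- exact: hX (false, i, j).
- by rewrite fineK//; apply: integrable_fin_num (hX (false, i, j)).
Qed.

(** Each norming functional commutes with the expectation and is at most the norm pointwise; the
    supremum over the family gives the bound. An infinite right side leaves nothing to prove. *)
Lemma specnorm_Emx_le m n (X : T -> 'M[C]_(m, n)) : random_mx X ->
  ((specnorm (Emx P X))%:E <= \int[P]_t (specnorm (X t))%:E)%E.
Proof.
move=> hX; have [hoo|] := ltP (\int[P]_t (specnorm (X t))%:E)%E +oo%E; last first.
  by move=> /(le_trans _); apply; rewrite leey.
have [B hB] := @specnorm_norming R m n.
have iX := specnorm_integrable hX hoo.
have fX := integrable_fin_num measurableT iX.
rewrite -(fineK fX) lee_fin; have [_] := hB (Emx P X); apply=> k.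
rewrite -lee_fin (fineK fX).
have [li <-] := has_integral_Emx (B k) (mx_integrable_of_specnorm hX hoo).
apply: le_integral => // t _; rewrite lee_fin.
by have [+ _] := hB (X t); exact.
Qed.

End expectation.

(** * Independence of a subfamily from one further matrix *)

Section independence.
Context {R : realType} {dsp : measure_display} {T : measurableType dsp}.
Variable P : probability T R.
Local Notation C := R[i].
Variables (N m n : nat) (Y : 'I_N -> T -> 'M[C]_(m, n)).
Hypotheses (rY : forall i, random_mx (Y i)) (indY : mx_independent P Y).

(* A pi-system generating the sigma-algebra of the subfamily indexed by [J]. *)
Definition mx_cylinder (J : {set 'I_N}) : set (set T) :=
  [set \bigcap_(i in [set i | i \in J]) A i |
    A in [set A | forall i, i \in J -> mx_sigma (Y i) (A i)]].

Lemma mx_sigma_measurable i A : mx_sigma (Y i) A -> measurable A.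
Proof.
apply: smallest_sub; first exact: sigma_algebra_measurable.
by move=> _ [k _ [B mB <-]]; exact: rY.
Qed.

Lemma mx_sigmaT i : mx_sigma (Y i) setT.
Proof. exact: (@measurableT _ (g_sigma_algebraType _)). Qed.

Lemma mx_cylinder_measurable J A : mx_cylinder J A -> measurable A.
Proof.
move=> [F hF <-]; apply: (fin_bigcap_measurable finite_finset).
by move=> i iJ; exact: (mx_sigma_measurable (hF i iJ)).
Qed.

Lemma mx_cylinder_setI J : setI_closed (mx_cylinder J).
Proof.
move=> _ _ [F hF <-] [G hG <-]; exists (fun i => F i `&` G i).
  move=> i iJ; exact: (@measurableI _ (g_sigma_algebraType _) _ _ (hF i iJ) (hG i iJ)).
by rewrite bigcapI.
Qed.

Lemma mx_cylinder_gen_measurable J A : <<s mx_cylinder J >> A -> measurable A.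
Proof.
apply: smallest_sub; first exact: sigma_algebra_measurable.
exact: mx_cylinder_measurable.
Qed.

(** As functions of [E], both sides are finite measures that agree on the pi-system of cylinders, so
    they agree on the sigma-algebra it generates. *)
Lemma independent_cylinder (J : {set 'I_N}) j E B : j \notin J ->
  <<s mx_cylinder J >> E -> mx_sigma (Y j) B -> P (E `&` B) = (P E * P B)%E.
Proof.
move=> jJ hE hB; have mB := mx_sigma_measurable hB.
pose c := NngNum (fine_ge0 (measure_ge0 P B)).
have cE : (c%:num%:E = P B)%E by rewrite /= fineK ?fin_num_measure.
rewrite muleC -cE.
apply: (@g_sigma_algebra_measure_unique _ _ _ (mx_cylinder J) _ (fun=> setT) _ _
  (mrestr P mB) (mscale c P)) => //.
- exact: mx_cylinder_measurable.
- move=> _; exists (fun=> setT); first by move=> i _; exact: mx_sigmaT.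
  by rewrite bigcapT.
- by rewrite bigcup_const//; exists 0%N.
- exact: mx_cylinder_setI.
- move=> _ [F hF <-].
  transitivity (P B * P (\bigcap_(i in [set i | i \in J]) F i))%E; last by rewrite -cE.
  transitivity (P (\bigcap_(i in [set i | i \in J]) F i `&` B)) => //.
  (* As [j] lies outside [J], placing [B] at index [j] turns the intersection into one cylinder over
     [j |: J], to which independence applies. *)
  pose F' i := if i == j then B else F i.
  have -> : \bigcap_(i in [set i | i \in J]) F i `&` B
      = \bigcap_(i in [set i | i \in j |: J]) F' i.
    apply/seteqP; split=> [t [tF tB] i|t tF].
      rewrite /F' /= in_setU1; case: eqVneq => //= _ iJ; exact: tF.
    split=> [i iJ|]; last by have := tF j; rewrite /F' eqxx; apply; rewrite /= setU11.
    have := tF i; rewrite /F'; case: eqVneq => [ij|_]; first by rewrite -ij [_ i]/= iJ in jJ.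
    by apply; rewrite /= setU1r.
  rewrite indY; last first.
    move=> i; rewrite /F' in_setU1; case: eqVneq => [->//|_ /= iJ]; exact: hF.
  rewrite big_setU1//= {1}/F' eqxx; congr (_ * _)%E.
  rewrite indY//; apply: eq_bigr => i iJ; rewrite /F'.
  by case: eqVneq => // ij; rewrite -ij iJ in jJ.
- by move=> _; change (P (setT `&` B) < +oo)%E; rewrite setTI ltey_eq fin_num_measure.
Qed.

(* Away from 0, the law of [h] times the indicator of [E] is [P E] times the
   law of [h], and the value 0 does not contribute to the integral. *)
Lemma integral_cylinder0 (J : {set 'I_N}) j E k : j \notin J -> <<s mx_cylinder J >> E ->
  has_integral P setT (mx_coord (Y j) k) 0 -> has_integral P E (mx_coord (Y j) k) 0.
Proof.
move=> jJ hE []; set h := mx_coord _ _ => hi h0.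
have mE := mx_cylinder_gen_measurable hE.
have hiE : P.-integrable E (EFin \o h) by apply: integrableS hi.
split=> //.
have mh : measurable_fun setT h by exact: rY.
pose h1 t : R := if t \in E then h t else 0.
have h1E : EFin \o h1 = (EFin \o h) \_ E.
  by apply/funext => t /=; rewrite patchE /h1; case: ifP.
have mh1 : measurable_fun setT h1.
  apply/measurable_EFinP; rewrite h1E.
  exact/(measurable_restrictT _ mE)/measurable_EFinP/measurable_funTS.
have ih1 : P.-integrable setT (EFin \o h1) by rewrite h1E; apply/(integrable_mkcond _ mE).
pose D : set R := ~` [set 0].
have mD : measurable D by apply: measurableC; exact: measurable_set1.
have mEFin : measurable_fun setT (@EFin R) by exact/measurable_EFinP.
pose c := NngNum (fine_ge0 (measure_ge0 P E)).
have cE : (c%:num%:E = P E)%E by rewrite /= fineK ?fin_num_measure.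
pose push g (mg : measurable_fun setT g) : {measure set R -> \bar R} :=
  measure_function_pushforward__canonical__measure_function_Measure P mg.
have intD (g : T -> R) : measurable_fun setT g ->
    (\int[P]_x (g x)%:E = \int[P]_(x in g @^-1` D) (EFin \o g) x)%E.
  move=> mg; rewrite [RHS]integral_mkcond; apply: eq_integral => x _.
  rewrite patchE; case: ifPn => //; rewrite notin_setE => /contrapT /= ->.
  by [].
have mpre (g : T -> R) : measurable_fun setT g -> measurable (g @^-1` D).
  by move=> mg; rewrite -[X in measurable X]setTI; exact: mg.
have pf (g : T -> R) : measurable_fun setT g -> P.-integrable setT (EFin \o g) ->
    (\int[pushforward P g]_(y in D) y%:E = \int[P]_x (g x)%:E)%E.
  move=> mg ig; rewrite intD// -(integral_pushforward mg mEFin)//.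
  by apply: integrableS ig => //; exact: mpre.
transitivity (\int[P]_x (h1 x)%:E)%E.
  by rewrite integral_mkcond -h1E.
rewrite -(pf _ mh1 ih1).
have iD : P.-integrable (h @^-1` D) (EFin \o h).
  by apply: integrableS hi => //; exact: mpre.
have {}iD := integrable_pushforward mh mEFin iD mD.
transitivity (\int[mscale c (push h mh)]_(y in D) y%:E)%E.
  (* For [A] avoiding 0, [h1] lies in [A] exactly on [E] intersected with the preimage of [A] under
     [h], and independence factors that probability. *)
  apply: (@eq_measure_integral _ _ _ _ (mscale c (push h mh)) (push h1 mh1)).
  move=> A mA AD.
  transitivity (P E * P (h @^-1` A))%E; last by rewrite -cE.
  rewrite -(independent_cylinder jJ hE); last first.
    by apply: sub_sigma_algebra; exists k => //; exists A => //; rewrite setTI.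
  congr (P _); apply/seteqP; split=> t /=; rewrite /h1.
    by case: ifPn => [/set_mem tE hA|_ /AD /(_ erefl) []].
  by move=> [tE hA]; rewrite mem_set.
(* The scalar is pulled out of the positive and negative parts separately; recombining them uses
   that the negative part has a finite integral. *)
rewrite integralE !ge0_integral_mscale//.
- rewrite -muleBr//; last first.
    by apply: fin_num_adde_defl; rewrite fin_numN; exact: (integrable_neg_fin_num mD iD).
  by rewrite -integralE pf// h0 mule0.
- by apply: measurable_funTS; exact: measurable_funeneg.
- by apply: measurable_funTS; exact: measurable_funepos.
Qed.

End independence.

(** * Comparing integrals through level sets *)

Section level_sets.
Context {R : realType} {dsp : measure_display} {T : measurableType dsp}.
Variable mu : {measure set T -> \bar R}.

(** This plays the role of [w <= E[f | G]]: [f] dominates in mean, on every event of the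
    sigma-algebra, each finite maximum of the steps [v k] on [F k]. These maxima increase to a limit
    that is at least [w], and monotone convergence concludes. *)
Lemma integral_le_levels (G : set (set T)) (F : nat -> set T) (v : nat -> R)
    (f w : T -> R) :
  G `<=` measurable -> (forall k, <<s G >> (F k)) -> (forall k, 0 <= v k) ->
  (forall t, 0 <= f t) -> measurable_fun setT f ->
  (forall k E, <<s G >> E -> E `<=` F k ->
    ((v k)%:E * mu E <= \int[mu]_(t in E) (f t)%:E)%E) ->
  (forall t, 0 <= w t) -> measurable_fun setT w ->
  (forall t (x : R), 0 <= x -> (forall k, F k t -> v k <= x) -> w t <= x) ->
  (\int[mu]_t (w t)%:E <= \int[mu]_t (f t)%:E)%E.
Proof.
move=> mG GF v0 f0 mf hF w0 mw hw.
pose TG : measurableType _ := g_sigma_algebraType G.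
have GT E : <<s G >> E -> measurable E.
  by apply: smallest_sub => //; exact: sigma_algebra_measurable.
pose fix g (n : nat) (t : T) {struct n} : R :=
  if n is n'.+1 then Num.max (g n' t) (v n' * \1_(F n') t) else 0.
have gS n t : g n.+1 t = Num.max (g n t) (v n * \1_(F n) t) by [].
have g0 n t : 0 <= g n t.
  by elim: n => [//|n ih]; rewrite gS le_max ih.
have mgG n : measurable_fun (setT : set TG) (g n).
  elim: n => [|n ih].
    exact: measurable_cst.
  rewrite (_ : g n.+1 = g n \max (fun t => v n * \1_(F n) t)).
    apply: measurable_maxr => //; apply: measurable_funM => //.
    by apply: measurable_indic; exact: GF.
  by apply/funext => t; rewrite gS.
have mg n : measurable_fun setT (g n).
  move=> _ B mB; rewrite setTI; apply: GT.
  by rewrite -[X in <<s _ >> X](@setTI TG); exact: mgG.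
have GI E E' : <<s G >> E -> <<s G >> E' -> <<s G >> (E `&` E').
  exact: (@measurableI _ TG).
have GD E E' : <<s G >> E -> <<s G >> E' -> <<s G >> (E `\` E').
  exact: (@measurableD _ TG).
(* The claim ranges over all events [E], because the induction step applies it to a smaller
   event. *)
have gle n : forall E, <<s G >> E ->
    (\int[mu]_(t in E) (g n t)%:E <= \int[mu]_(t in E) (f t)%:E)%E.
  elim: n => [|n ih] E GE.
    by rewrite integral0 integral_ge0// => t _; rewrite lee_fin.
  (* [E1] is where level [n] beats the earlier maximum: there the new maximum is the constant [v n],
     and on the rest of [E] it equals [g n]. *)
  pose E1 := E `&` (F n `&` [set t | g n t < v n]).
  have GE1 : <<s G >> E1.
    apply: (GI) => //; apply: GI => //.
    have := mgG n measurableT _ (measurable_itv `]-oo, v n[).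
    by rewrite setTI; congr (<<s G >> _); apply/seteqP; split=> t /=; rewrite in_itv.
  have GE2 : <<s G >> (E `\` E1) by exact: GD.
  have EE : E = E1 `|` (E `\` E1) by rewrite setDUK//; exact: subIsetl.
  have dE : [disjoint E1 & E `\` E1] by apply/disj_setPS => t [? []].
  have split_int (h : T -> R) : (forall t, 0 <= h t) -> measurable_fun setT h ->
      (\int[mu]_(t in E) (h t)%:E =
       \int[mu]_(t in E1) (h t)%:E + \int[mu]_(t in E `\` E1) (h t)%:E)%E.
    move=> h0 mh; rewrite {1}EE ge0_integral_setU//.
    - exact: GT.
    - exact: GT.
    - by apply/measurable_EFinP; exact: measurable_funTS.
    - by move=> t _; rewrite lee_fin.
  rewrite (split_int _ (g0 n.+1) (mg n.+1)) (split_int _ f0 mf); apply: leeD.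
    rewrite (_ : (\int[mu]_(t in E1) _ = (v n)%:E * mu E1)%E).
      by apply: hF => // t [_ []].
    rewrite -integral_cst; last exact: GT.
    apply: eq_integral => t /set_mem [_ [Ft /= gv]].
    by rewrite indicE mem_set//= mulr1 max_r// ltW.
  rewrite (_ : (\int[mu]_(t in E `\` E1) (g n.+1 t)%:E
      = \int[mu]_(t in E `\` E1) (g n t)%:E)%E); first exact: ih.
  apply: eq_integral => t /set_mem [Et nE1]; congr EFin.
  rewrite gS indicE; case: (boolP (t \in F n)) => [/set_mem Ft|_]; last first.
    by rewrite mulr0 max_l.
  by rewrite mulr1 max_l// leNgt; apply/negP => gv; apply: nE1.
have ndg t : {homo (fun n => (g n t)%:E) : n m / (n <= m)%N >-> (n <= m)%E}.
  by apply/nondecreasing_seqP => n; rewrite lee_fin gS le_max lexx.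
have limE t : limn (fun n => (g n t)%:E) = esups (fun n => (g n t)%:E) 0.
  rewrite (cvg_lim _ (ereal_nondecreasing_cvgn (ndg t)))//.
  by congr ereal_sup; apply/seteqP; split=> _ [k _ <-]; exists k.
apply: (@le_trans _ _ (\int[mu]_t limn (fun n => (g n t)%:E))%E).
  apply: ge0_le_integral => //.
  - by move=> t _; rewrite lee_fin.
  - exact/measurable_EFinP.
  - rewrite [X in measurable_fun _ X](_ : _ = (fun t => esups (fun n => (g n t)%:E) 0)).
      by apply: measurable_fun_esups => k; exact/measurable_EFinP.
    by apply/funext => t; rewrite limE.
  - move=> t _; rewrite limE.
    have ub k : ((g k t)%:E <= esups (fun n => (g n t)%:E) 0%N)%E.
      by apply: ereal_sup_ubound; exists k.
    case: (esups _ _) ub => [x| |] ub; [|exact: leey|].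
      rewrite lee_fin; apply: hw => [|k Fk]; rewrite -lee_fin.
        by apply: le_trans (ub 0%N).
      (* Level [k] enters the maximum only at stage [k.+1]. *)
      apply: le_trans (ub k.+1).
      by rewrite lee_fin gS indicE mem_set// mulr1 le_max lexx orbT.
    by have := ub 0%N; rewrite leNgt ltNyr.
have c : (\int[mu]_t (g n t)%:E @[n --> \oo] -->
    \int[mu]_t limn (fun n => (g n t)%:E))%E.
  apply: (@cvg_monotone_convergence _ _ _ mu setT measurableT
    (fun n t => (g n t)%:E)) => //.
  - by move=> n; exact/measurable_EFinP.
  - by move=> n t _; rewrite lee_fin.
rewrite -(cvg_lim _ c)//; apply: lime_le; first exact: cvgP c.
by apply: nearW => n; apply: gle; exact: (@measurableT _ TG).
Qed.

End level_sets.

(** * Partial sums and the maximal summand of a centered independent family *)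

Section independent_sums.
Context {R : realType} {dsp : measure_display} {T : measurableType dsp}.
Variable P : probability T R.
Local Notation C := R[i].
Variables (N m n : nat) (Y : 'I_N -> T -> 'M[C]_(m, n)).
Hypotheses (rY : forall i, random_mx (Y i)) (indY : mx_independent P Y)
  (iY : forall i, mx_integrable P (Y i)) (EY : forall i, Emx P (Y i) = 0).

(** An event of [Y i] is a cylinder whose other factors are the whole space. Measurability here is
    for the smaller sigma-algebra of the subfamily, which the level sets of partial sums require. *)
Lemma random_mx_cylinder (J : {set 'I_N}) i : i \in J ->
  random_mx (T := g_sigma_algebraType (mx_cylinder Y J)) (Y i).
Proof.
move=> iJ k _ B mB; rewrite setTI; apply: sub_sigma_algebra.
exists (fun i' => if i' == i then mx_coord (Y i) k @^-1` B else setT).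
  move=> i' _; case: eqVneq => [->|_]; last exact: mx_sigmaT.
  by apply: sub_sigma_algebra; exists k => //; exists B => //; rewrite setTI.
apply/seteqP; split=> [t /(_ i iJ)|t tB i' _]; first by rewrite eqxx.
by case: eqVneq.
Qed.

Lemma lform_level_cylinder (J : {set 'I_N}) B (c : R) :
  <<s mx_cylinder Y J >> [set t | c <= lform B (\sum_(i in J) Y i t)].
Proof.
have rU : random_mx (T := g_sigma_algebraType (mx_cylinder Y J))
    (fun t => \sum_(i in J) Y i t).
  by apply: random_mx_sum => i iJ; exact: random_mx_cylinder.
have := measurable_lform B rU measurableT (measurable_itv `[c, +oo[).
rewrite setTI; congr (<<s _ >> _).
by apply/seteqP; split=> t /=; rewrite in_itv/= andbT.
Qed.

Lemma has_integral_coord0 i k : has_integral P setT (mx_coord (Y i) k) 0.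
Proof.
split; first exact: iY.
rewrite -[LHS]fineK; last exact: integrable_fin_num (iY i k).
move: k => [[[] a] b]; congr EFin.
  by have /matrixP/(_ a b) := EY i; rewrite !mxE => /(congr1 (@complex.Re R)).
by have /matrixP/(_ a b) := EY i; rewrite !mxE => /(congr1 (@complex.Im R)).
Qed.

Lemma lform0r (B : 'M[C]_(m, n)) : lform B 0 = 0.
Proof. by apply: (addrI (lform B 0)); rewrite -lformD !addr0. Qed.

Lemma measurable_specnorm_sum2 (J : {set 'I_N}) :
  measurable_fun setT (fun t => specnorm (\sum_(i in J) Y i t) ^+ 2).
Proof.
by apply: measurable_funX; apply: measurable_specnorm; exact: random_mx_sum.
Qed.

(* If [phi = lform B] is dominated by the norm then, with [U] and [V] the sums
   over [J] and its complement, [c <= phi U] and [0 <= c] give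
   [c^2 + 2 c phi V <= |U + V|^2], and [phi V] integrates to 0 over [E]. *)
Lemma level_le_sum2 (J : {set 'I_N}) B (c : R) E :
  (forall A, lform B A <= specnorm A) -> 0 <= c -> <<s mx_cylinder Y J >> E ->
  E `<=` [set t | c <= lform B (\sum_(i in J) Y i t)] ->
  ((c ^+ 2)%:E * P E <= \int[P]_(t in E) (specnorm (\sum_i Y i t) ^+ 2)%:E)%E.
Proof.
move=> hB c0 hE EJ; have mE := mx_cylinder_gen_measurable rY hE.
have mZ : measurable_fun setT (fun t => specnorm (\sum_i Y i t) ^+ 2).
  by apply: measurable_funX; apply: measurable_specnorm; exact: random_mx_sum.
have [hoo|] := ltP (\int[P]_(t in E) (specnorm (\sum_i Y i t) ^+ 2)%:E)%E +oo%E; last first.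
  by move=> /(le_trans _); apply; rewrite leey.
have iZ : P.-integrable E (fun t => (specnorm (\sum_i Y i t) ^+ 2)%:E).
  apply/integrableP; split.
    by apply/measurable_EFinP; exact: measurable_funTS.
  by under eq_integral do rewrite gee0_abs ?lee_fin ?sqr_ge0//.
pose V t := \sum_(i | i \notin J) Y i t.
have hV : has_integral P E (fun t => lform B (V t)) 0.
  have s0 : 0 = \sum_(i < N | i \notin J) 0 :> R by rewrite big1_eq.
  rewrite -(lform0r B); apply: has_integral_lform => // a b; rewrite mxE /=.
  - rewrite (_ : (fun t => _) =
        (fun t => \sum_(i | i \notin J) complex.Re (Y i t a b))); last first.
      by apply/funext => t; rewrite /V summxE cRe_sum.
    rewrite [X in has_integral _ _ _ X]s0.
    apply: has_integral_sum => // i iJ.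
    exact: (integral_cylinder0 rY indY iJ hE (has_integral_coord0 i (true, a, b))).
  - rewrite (_ : (fun t => _) =
        (fun t => \sum_(i | i \notin J) complex.Im (Y i t a b))); last first.
      by apply/funext => t; rewrite /V summxE cIm_sum.
    rewrite [X in has_integral _ _ _ X]s0.
    apply: has_integral_sum => // i iJ.
    exact: (integral_cylinder0 rY indY iJ hE (has_integral_coord0 i (false, a, b))).
have hc : has_integral P E (cst (c ^+ 2)) (c ^+ 2 * fine (P E)).
  split; first exact: finite_measure_integrable_cst.
  rewrite [RHS]EFinM fineK ?fin_num_measure//; exact: (integral_cst P mE (c ^+ 2)%:E).
have [iL IL] := has_integralD mE hc (has_integralZ mE (2 * c) hV).
rewrite -(fineK (fin_num_measure P _ mE)) -EFinM.
rewrite mulr0 addr0 in IL; rewrite -IL.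
apply: le_integral => // t /set_mem Et; rewrite lee_fin /=.
have h1 : c <= lform B (\sum_(i in J) Y i t) := EJ t Et.
have h2 := hB (\sum_i Y i t).
have ZE : \sum_i Y i t = \sum_(i in J) Y i t + V t by rewrite (bigID (mem J)).
move: h2; rewrite {1}ZE lformD => h2.
(* With [z] the norm of the full sum, [(z - c)^2 >= 0] gives [z^2 >= 2 c z - c^2], and
   [z >= c + lform B (V t)] turns this into the integrand on the left. *)
have h3 := specnorm_ge0 (\sum_i Y i t); have := sqr_ge0 (specnorm (\sum_i Y i t) - c).
by nra.
Qed.

(** Levels are indexed by pairs of a norming functional and a rational threshold. The squared
    thresholds reached at [t] have the squared norm of the partial sum as supremum. *)
Lemma integral_partial_sum_le (J : {set 'I_N}) :
  (\int[P]_t (specnorm (\sum_(i in J) Y i t) ^+ 2)%:E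
   <= \int[P]_t (specnorm (\sum_i Y i t) ^+ 2)%:E)%E.
Proof.
have [B hB] := @specnorm_norming R m n.
pose lev k : option (nat * rat) := unpickle k.
pose F k := if lev k is Some p
  then [set t | ratr p.2 <= lform (B p.1) (\sum_(i in J) Y i t)] else set0.
(* Negative thresholds get the value 0, since the square of a negative threshold gives no valid
   lower bound. *)
pose v k : R := if lev k is Some p then (if 0 <= p.2 then ratr p.2 ^+ 2 else 0) else 0.
apply: (@integral_le_levels _ _ _ P (mx_cylinder Y J) F v) => //.
- exact: mx_cylinder_measurable.
- move=> k; rewrite /F; case: (lev k) => [p|]; first exact: lform_level_cylinder.
  exact: (@measurable0 _ (g_sigma_algebraType _)).
- by move=> k; rewrite /v; case: (lev k) => // p; case: ifP; rewrite ?sqr_ge0.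
- by move=> t; rewrite sqr_ge0.
- by apply: measurable_funX; apply: measurable_specnorm; exact: random_mx_sum.
- have nn E : (0 * P E <= \int[P]_(t in E) (specnorm (\sum_i Y i t) ^+ 2)%:E)%E.
    by rewrite mul0e; apply: integral_ge0 => t _; rewrite lee_fin sqr_ge0.
  move=> k E hE; rewrite /F /v; case: (lev k) => [p|_]; last exact: nn.
  case: ifPn => [p0 EF|_ _]; last exact: nn.
  apply: (level_le_sum2 _ _ hE EF); last by rewrite ler0q.
  by move=> A; have [+ _] := hB A; exact.
- by move=> t; rewrite sqr_ge0.
- exact: measurable_specnorm_sum2.
move=> t x x0 hx.
rewrite -(sqr_sqrtr x0) ler_pXn2r// ?nnegrE ?sqrtr_ge0 ?specnorm_ge0//.
have [_] := hB (\sum_(i in J) Y i t); apply=> k.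
(* If a functional exceeded the root of [x], a rational [q] in between would be a reached threshold
   with [q^2 > x]. *)
rewrite leNgt; apply/negP => /rat_in_itvoo[q]; rewrite in_itv/= => /andP[q1 q2].
have q0 : 0 <= (ratr q : R) by apply: le_trans (ltW q1); exact: sqrtr_ge0.
have := hx (pickle (k, q)); rewrite /F /v /lev pickleK /= -(ler0q R) q0.
move=> /(_ (ltW q2)); rewrite -{1}(sqr_sqrtr x0) ler_pXn2r ?nnegrE ?sqrtr_ge0//.
by rewrite leNgt q1.
Qed.

Lemma measurable_bigmax I (r : seq I) (f : I -> T -> R) :
  (forall i, measurable_fun setT (f i)) ->
  measurable_fun setT (fun t => \big[Num.max/0]_(i <- r) f i t).
Proof.
move=> mf; elim: r => [|i r ih].
  rewrite (_ : (fun t => _) = cst 0); first exact: measurable_cst.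
  by apply/funext => t; rewrite big_nil.
rewrite (_ : (fun t => _) = f i \max (fun t => \big[Num.max/0]_(j <- r) f j t)).
  exact: measurable_maxr.
by apply/funext => t; rewrite big_cons.
Qed.

Lemma sqr_le_2sqrD (y a b : R) :
  0 <= y -> y <= a + b -> y ^+ 2 <= 2 * (a ^+ 2 + b ^+ 2).
Proof.
move=> y0 yab; have := ler_pM y0 y0 yab yab; have := sqr_ge0 (a - b).
by rewrite !expr2; lra.
Qed.

(** Summing over [i], both [u] and its composition with [s] contribute the same total, which doubles
    the factor 2 to 4. *)
Lemma card_mul_le_sum_involution (I : finType) (s : I -> I) (u : I -> R) (y : R) :
  involutive s -> (forall i, y <= 2 * (u i + u (s i))) ->
  #|I|%:R * y <= 4 * \sum_i u i.
Proof.
move=> sK h; have su : \sum_i u (s i) = \sum_i u i.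
  by rewrite [RHS](reindex_inj (inv_inj sK)).
apply: (@le_trans _ _ (\sum_i 2 * (u i + u (s i)))).
  by rewrite mulr_natl -sumr_const; apply: ler_sum => i _; exact: h.
by rewrite -mulr_sumr big_split/= su; lra.
Qed.

(* [J] and its symmetric difference with [{j}] give partial sums that differ by
   [+- Y j]. *)
Lemma max_specnorm_le_partial_sums t :
  #|{set 'I_N}|%:R * \big[Num.max/0]_i specnorm (Y i t) ^+ 2
  <= 4 * \sum_(J : {set 'I_N}) specnorm (\sum_(i in J) Y i t) ^+ 2.
Proof.
pose u (J : {set 'I_N}) := specnorm (\sum_(i in J) Y i t).
have M0 : 0 < #|{set 'I_N}|%:R :> R.
  by rewrite ltr0n; apply/card_gt0P; exists finset.set0.
have S0 : 0 <= \sum_J u J ^+ 2 by apply: sumr_ge0 => J _; rewrite sqr_ge0.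
rewrite mulrC -ler_pdivlMr//; apply: bigmax_le.
  by rewrite divr_ge0 ?mulr_ge0// ltW.
move=> j _; rewrite ler_pdivlMr//.
pose flip (J : {set 'I_N}) := if j \in J then J :\ j else j |: J.
have flipK : involutive flip.
  move=> J; rewrite /flip; case: (boolP (j \in J)) => jJ.
    by rewrite finset.setD11 finset.setD1K.
  by rewrite finset.setU11 finset.setU1K.
have hu J : specnorm (Y j t) ^+ 2 <= 2 * (u J ^+ 2 + u (flip J) ^+ 2).
  have tri : specnorm (Y j t) <= u J + u (flip J).
    rewrite /u /flip; case: (boolP (j \in J)) => jJ.
      rewrite {1}(big_setD1 j)//=; set S := \sum_(i in _) _.
      rewrite -{1}(addrK S (Y j t)) -[specnorm S]specnormN; exact: specnormD.
    rewrite (big_setU1 _ jJ)/=; set S := \sum_(i in _) _.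
    rewrite -{1}(addrK S (Y j t)) [leRHS]addrC -[specnorm S]specnormN.
    exact: specnormD.
  exact: sqr_le_2sqrD (specnorm_ge0 _) tri.
rewrite mulrC; exact: card_mul_le_sum_involution flipK hu.
Qed.

(** The pointwise average over all index sets is integrated and each partial sum is replaced by the
    full sum; the number [M] of index sets then cancels. *)
Lemma integral_max_le_sum :
  (\int[P]_t (\big[Num.max/0]_i specnorm (Y i t) ^+ 2)%:E
   <= 4%:E * \int[P]_t (specnorm (\sum_i Y i t) ^+ 2)%:E)%E.
Proof.
set X := (\int[P]_t (specnorm (\sum_i Y i t) ^+ 2)%:E)%E.
have X0 : (0 <= X)%E by apply: integral_ge0 => t _; rewrite lee_fin sqr_ge0.
pose M : R := #|{set 'I_N}|%:R.
have M0 : 0 < M by rewrite ltr0n; apply/card_gt0P; exists finset.set0.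
have M4 : 0 < 4 / M by rewrite divr_gt0.
apply: (@le_trans _ _ (\int[P]_t (\sum_(J : {set 'I_N})
    (4 / M)%:E * (specnorm (\sum_(i in J) Y i t) ^+ 2)%:E))%E).
  apply: ge0_le_integral => //.
  - by move=> t _; rewrite lee_fin; apply: bigmax_ge_id.
  - apply/measurable_EFinP; apply: measurable_bigmax => i.
    by apply: measurable_funX; exact: measurable_specnorm.
  - apply: emeasurable_sum => J; apply/measurable_EFinP.
    by apply: measurable_funM => //; exact: measurable_specnorm_sum2.
  - move=> t _; under [X in (_ <= X)%E]eq_bigr do rewrite -EFinM.
    rewrite sumEFin lee_fin -mulr_sumr mulrAC ler_pdivlMr// mulrC.
    exact: max_specnorm_le_partial_sums.
rewrite ge0_integral_sum//; last 2 first.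
- move=> J; apply/measurable_EFinP.
  by apply: measurable_funM => //; exact: measurable_specnorm_sum2.
- by move=> J t _; rewrite -EFinM lee_fin mulr_ge0 ?sqr_ge0// divr_ge0// ltW.
apply: (@le_trans _ _ (\sum_(J : {set 'I_N}) (4 / M)%:E * X)%E).
  apply: lee_sum => J _.
  have mJ : measurable_fun setT (fun t => (specnorm (\sum_(i in J) Y i t) ^+ 2)%:E).
    by apply/measurable_EFinP; exact: measurable_specnorm_sum2.
  have J0 t : [set: T] t -> (0 <= (specnorm (\sum_(i in J) Y i t) ^+ 2)%:E)%E.
    by move=> _; rewrite lee_fin sqr_ge0.
  rewrite (ge0_integralZl_EFin P measurableT J0 mJ (ltW M4)).
  by apply: lee_wpmul2l; [rewrite lee_fin ltW | exact: integral_partial_sum_le].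
rewrite -ge0_sume_distrl; last by move=> J _; rewrite lee_fin divr_ge0// ltW.
rewrite sumEFin sumr_const -(mulr_natr (4 / M)) -/M.
by rewrite divfK ?gt_eqF.
Qed.

End independent_sums.

(** * The lower bounds for centered and for positive-semidefinite sums *)

Section lower_bounds.
Context {R : realType} {dsp : measure_display} {T : measurableType dsp}.
Variable P : probability T R.
Local Notation C := R[i].

Lemma poweR_half_fin (r : R) : 0 <= r -> poweR r%:E (1 / 2) = (Num.sqrt r)%:E.
Proof. by move=> r0; rewrite div1r poweR12_sqrt ?lee_fin. Qed.

Lemma sqrt_specnorm_Emx_le m n p (Z : T -> 'M[C]_(m, n)) (M : T -> 'M[C]_p) (x : R) :
  random_mx Z -> random_mx M -> (forall t, specnorm (M t) <= specnorm (Z t) ^+ 2) ->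
  (\int[P]_t (specnorm (Z t) ^+ 2)%:E = x%:E)%E ->
  Num.sqrt (specnorm (Emx P M)) <= Num.sqrt x.
Proof.
move=> rZ rM MZ Zx; apply: ler_wsqrtr; rewrite -lee_fin -Zx.
apply: le_trans (specnorm_Emx_le P rM) _; apply: ge0_le_integral => //.
- by move=> t _; rewrite lee_fin specnorm_ge0.
- by apply/measurable_EFinP; exact: measurable_specnorm.
- by apply/measurable_EFinP; apply: measurable_funX; exact: measurable_specnorm.
- by move=> t _; rewrite lee_fin.
Qed.

(** If the second moment [x] of the norm is finite, the first maximum is at most [sqrt x] and the
    root of the maximal term at most [2 sqrt x]; the weights satisfy [1/2 + 2/4 = 1]. An infinite
    second moment makes the right side infinite. *)
Lemma centered_sum_lower_bound (n d1 d2 : nat) (S : 'I_n -> T -> 'M[C]_(d1, d2)) :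
  (forall i, random_mx (S i)) ->
  mx_independent P S ->
  (forall i, mx_integrable P (S i)) ->
  (forall i, Emx P (S i) = 0) ->
  let Z := fun t => \sum_(i < n) S i t in
  is_true ((1 / 2 * Num.max (Num.sqrt (specnorm (Emx P (fun t => Z t *m adjmx (Z t)))))
                    (Num.sqrt (specnorm (Emx P (fun t => adjmx (Z t) *m Z t)))))%:E
   + (1 / 4)%:E *
     poweR (\int[P]_t (\big[Num.max/0]_(i < n) specnorm (S i t) ^+ 2)%:E) (1 / 2)
   <= poweR (\int[P]_t (specnorm (Z t) ^+ 2)%:E) (1 / 2))%E.
Proof.
move=> rS indS iS ES Z.
have rZ : random_mx Z by exact: random_mx_sum.
have rZ' := random_mx_adj rZ.
have X0 : (0 <= \int[P]_t (specnorm (Z t) ^+ 2)%:E)%E.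
  by apply: integral_ge0 => t _; rewrite lee_fin sqr_ge0.
have M0 : (0 <= \int[P]_t (\big[Num.max/0]_(i < n) specnorm (S i t) ^+ 2)%:E)%E.
  by apply: integral_ge0 => t _; rewrite lee_fin; exact: bigmax_ge_id.
have := integral_max_le_sum rS indS iS ES.
rewrite -/Z; move EX : (\int[P]_t (specnorm (Z t) ^+ 2)%:E)%E X0 => X X0.
case: X EX X0 => [x| |//] EX x0; last by rewrite poweRyr ?leey// div1r invr_eq0.
move: M0; set M := (\int[P]_t _)%E; case: M => [w| |//] w0; last by rewrite leye_eq.
rewrite -EFinM lee_fin => wx; rewrite !lee_fin in w0 x0.
rewrite (poweR_half_fin w0) (poweR_half_fin x0) -EFinM -EFinD lee_fin.
have wx' : Num.sqrt w <= 2 * Num.sqrt x.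
  apply: le_trans (ler_wsqrtr wx) _.
  by rewrite sqrtrM// (_ : 4 = 2 ^+ 2) ?sqrtr_sqr ?ger0_norm//; ring.
have hmax : Num.max (Num.sqrt (specnorm (Emx P (fun t => Z t *m adjmx (Z t)))))
    (Num.sqrt (specnorm (Emx P (fun t => adjmx (Z t) *m Z t)))) <= Num.sqrt x.
  rewrite ge_max; apply/andP; split; apply: (sqrt_specnorm_Emx_le rZ _ _ EX).
  - exact: random_mxM.
  - by move=> t; rewrite (le_trans (specnormM _ _))// specnorm_adj expr2.
  - exact: random_mxM.
  - by move=> t; rewrite (le_trans (specnormM _ _))// specnorm_adj expr2.
by move: (Num.max _ _) (Num.sqrt w) (Num.sqrt x) hmax wx' => a b c; lra.
Qed.

Lemma is_psd_sum N d (Q : pred 'I_N) (A : 'I_N -> 'M[C]_d) :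
  (forall i, is_psd (A i)) -> is_psd (\sum_(i | Q i) A i).
Proof.
move=> hA; elim/big_rec: _ => [|i B _ [hB B0]].
  split=> [|x]; first by apply/matrixP => i j; rewrite adjmxE !mxE conjc0.
  by rewrite mulmx0 mul0mx mxE.
have [hAi Ai0] := hA i; split=> [|x].
  by apply/matrixP => a b; rewrite adjmxE !mxE rmorphD/= -!adjmxE hAi hB.
by rewrite mulmxDr mulmxDl mxE addr_ge0.
Qed.

(** Both quantities under the roots are at most the expected norm of [W], so the bracket is at most
    twice its root, and squaring produces the factor 4. *)
Lemma psd_sum_lower_bound (n d : nat) (Tm : 'I_n -> T -> 'M[C]_d) :
  (forall i, random_mx (Tm i)) ->
  (forall i t, is_psd (Tm i t)) ->
  let W := fun t => \sum_(i < n) Tm i t in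
  is_true ((1 / 4)%:E *
     ((Num.sqrt (specnorm (Emx P W)))%:E
      + poweR (\int[P]_t (\big[Num.max/0]_(i < n) specnorm (Tm i t))%:E) (1 / 2)) ^+ 2
   <= \int[P]_t (specnorm (W t))%:E)%E.
Proof.
move=> rT psdT W.
have rW : random_mx W by exact: random_mx_sum.
have X0 : (0 <= \int[P]_t (specnorm (W t))%:E)%E.
  by apply: integral_ge0 => t _; rewrite lee_fin specnorm_ge0.
have M0 : (0 <= \int[P]_t (\big[Num.max/0]_(i < n) specnorm (Tm i t))%:E)%E.
  by apply: integral_ge0 => t _; rewrite lee_fin; exact: bigmax_ge_id.
have := specnorm_Emx_le P rW.
have : (\int[P]_t (\big[Num.max/0]_(i < n) specnorm (Tm i t))%:E
    <= \int[P]_t (specnorm (W t))%:E)%E.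
  apply: ge0_le_integral => //.
  - by move=> t _; rewrite lee_fin; exact: bigmax_ge_id.
  - by apply/measurable_EFinP; apply: measurable_bigmax => i; exact: measurable_specnorm.
  - by apply/measurable_EFinP; exact: measurable_specnorm.
  - move=> t _; rewrite lee_fin; apply: bigmax_le => [|i _]; first exact: specnorm_ge0.
    have -> : W t = Tm i t + \sum_(k | k != i) Tm k t by rewrite /W (bigD1 i).
    apply: specnorm_psd_le; first exact: psdT.
    by apply: is_psd_sum => k; exact: psdT.
move: X0 M0; set X := (\int[P]_t (specnorm (W t))%:E)%E; case: X => [x| |//]; last first.
  by move=> *; rewrite leey.
set M := (\int[P]_t _)%E; case: M => [w| |//]; last by move=> _ _; rewrite leye_eq.
rewrite !lee_fin => x0 w0 wx ex.
have -> : w `^ (1 / 2) = Num.sqrt w by rewrite div1r powR12_sqrt.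
have h1 := ler_wsqrtr wx; have h2 := ler_wsqrtr ex.
have s0 : 0 <= Num.sqrt (specnorm (Emx P W)) + Num.sqrt w by rewrite addr_ge0 ?sqrtr_ge0.
have h : Num.sqrt (specnorm (Emx P W)) + Num.sqrt w <= 2 * Num.sqrt x by lra.
have := ler_pM s0 s0 h h; have := sqr_sqrtr x0; rewrite !expr2.
by move: (_ + Num.sqrt w) (Num.sqrt x) => a b; lra.
Qed.

End lower_bounds.

Theorem theorem6p1 (R : realType) (dsp : measure_display)
    (T : measurableType dsp) (P : probability T R) :
  (* (1) sums of independent PSD random matrices *)
  (forall (n d : nat) (Tm : 'I_n -> T -> 'M[R[i]]_d),
      (forall i, random_mx (Tm i)) ->
      mx_independent P Tm ->
      (forall i t, is_psd (Tm i t)) ->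
      let W := fun t => \sum_(i < n) Tm i t in
      ((1 / 4)%:E *
         ((Num.sqrt (specnorm (Emx P W)))%:E
          + poweR (\int[P]_t (\big[Num.max/0]_(i < n) specnorm (Tm i t))%:E)
                  (1 / 2)) ^+ 2
       <= \int[P]_t (specnorm (W t))%:E)%E) /\
  (* (2) sums of independent centered Hermitian random matrices *)
  (forall (n d : nat) (Y : 'I_n -> T -> 'M[R[i]]_d),
      (forall i, random_mx (Y i)) ->
      mx_independent P Y ->
      (forall i t, is_hermitian (Y i t)) ->
      (forall i, mx_integrable P (Y i)) ->
      (forall i, Emx P (Y i) = 0) ->
      let X := fun t => \sum_(i < n) Y i t in
      ((1 / 2 * Num.sqrt (specnorm (Emx P (fun t => X t *m X t))))%:E
       + (1 / 4)%:E *
         poweR (\int[P]_t (\big[Num.max/0]_(i < n) specnorm (Y i t) ^+ 2)%:E)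
               (1 / 2)
       <= poweR (\int[P]_t (specnorm (X t) ^+ 2)%:E) (1 / 2))%E) /\
  (* (3) sums of independent centered rectangular random matrices *)
  (forall (n d1 d2 : nat) (S : 'I_n -> T -> 'M[R[i]]_(d1, d2)),
      (forall i, random_mx (S i)) ->
      mx_independent P S ->
      (forall i, mx_integrable P (S i)) ->
      (forall i, Emx P (S i) = 0) ->
      let Z := fun t => \sum_(i < n) S i t in
      ((1 / 2 * Num.max (Num.sqrt (specnorm (Emx P (fun t => Z t *m adjmx (Z t)))))
                        (Num.sqrt (specnorm (Emx P (fun t => adjmx (Z t) *m Z t)))))%:E
       + (1 / 4)%:E *
         poweR (\int[P]_t (\big[Num.max/0]_(i < n) specnorm (S i t) ^+ 2)%:E)
               (1 / 2)
       <= poweR (\int[P]_t (specnorm (Z t) ^+ 2)%:E) (1 / 2))%E).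
Proof.
split; first by move=> n d Tm rT _ psdT; exact: psd_sum_lower_bound.
split; last by move=> n d1 d2 S; exact: centered_sum_lower_bound.
move=> n d Y rY indY hY iY EY.
have hX t : adjmx (\sum_(i < n) Y i t) = \sum_(i < n) Y i t.
  apply/matrixP => a b; rewrite adjmxE !summxE raddf_sum.
  by apply: eq_bigr => i _; rewrite /= -adjmxE hY.
have := centered_sum_lower_bound rY indY iY EY; cbv zeta beta.
(* For a self-adjoint sum both products are its square, so the maximum has two equal entries. *)
rewrite (_ : (fun t => _ *m adjmx _) =
  (fun t => (\sum_(i < n) Y i t) *m \sum_(i < n) Y i t)); last first.
  by apply/funext => t; rewrite hX.
rewrite (_ : (fun t => adjmx _ *m _) =
  (fun t => (\sum_(i < n) Y i t) *m \sum_(i < n) Y i t)); last first.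
  by apply/funext => t; rewrite hX.
by rewrite maxxx.
Qed.
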